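(* Let $\zeta>0$ and let $n\ge1$. The $n$ zeros $\{x_{i,n}^{(1)}\}_{i=1}^n$ of $P_n^{(1)}(\cdot;\zeta)$ and the $n+1$ zeros $\{x_{i,n+1}^{(0)}\}_{i=1}^{n+1}$ of $P_{n+1}^{(0)}(\cdot;\zeta)$ satisfy $$1<x_{1,n+1}^{(0)}<x_{1,n}^{(1)}<x_{2,n+1}^{(0)}<\cdots<x_{n,n}^{(1)}<x_{n+1,n+1}^{(0)}.$$
   Context: For $\zeta>0$ let $K_1(\zeta)=\int_0^\infty\cosh(\vartheta)e^{-\zeta\cosh\vartheta}d\vartheta$. For $\ell\in\{0,1\}$ let $\omega^{(\ell)}(x;\zeta)=K_1(\zeta)^{-1}(x^2-1)^{\ell-1/2}e^{-\zeta x}$ on $[1,\infty)$ and $(f,g)_{\omega^{(\ell)}}=\int_1^\infty f(x)g(x)\omega^{(\ell)}(x;\zeta)dx$. $\{P_n^{(\ell)}(x;\zeta)\}_{n\ge0}$ are the orthonormal polynomials in $x$ for $(\cdot,\cdot)_{\omega^{(\ell)}}$, $\deg P_n^{(\ell)}=n$, with positive leading coefficient. $P_n^{(\ell)}$ has exactly $n$ simple real zeros, all in $(1,\infty)$, denoted in increasing order $x_{1,n}^{(\ell)}<\dots<x_{n,n}^{(\ell)}$. *)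

(* Defs.v *)
From HB Require Import structures.
From mathcomp Require Import all_boot all_order all_algebra.
From mathcomp Require Import all_classical all_reals all_analysis.
From mathcomp Require Import polyrcf.

Set Implicit Arguments.
Unset Strict Implicit.
Unset Printing Implicit Defensive.

Import Order.TTheory GRing.Theory Num.Theory.
Import numFieldNormedType.Exports.

Local Open Scope classical_set_scope.
Local Open Scope ring_scope.

Definition cosh {R : realType} (t : R) : R := (expR t + expR (- t)) / 2.

(* The modified Bessel function K_1, for zeta > 0. *)
Definition besselK1 {R : realType} (zeta : R) : R :=
  \int[@lebesgue_measure R]_(t in `[0, +oo[) (cosh t * expR (- zeta * cosh t)).

(* For l = 0 the weight is singular at x = 1, where powR gives the junk value
   0 `^ (- 1 / 2) = 0; this does not affect integrals over [1, +oo[. *)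
Definition weight {R : realType} (l : nat) (zeta x : R) : R :=
  (besselK1 zeta)^-1 * (x ^+ 2 - 1) `^ (l%:R - 1 / 2) * expR (- zeta * x).

Definition inner {R : realType} (l : nat) (zeta : R) (f g : R -> R) : R :=
  \int[@lebesgue_measure R]_(x in `[1, +oo[) (f x * g x * weight l zeta x).

(* Integrability needs no separate clause: Rintegral returns 0 for an infinite
   integral, so (P n, P n) = 1 already forces the square of P n to be
   integrable against the weight. *)
Definition orthonormal_polys {R : realType} (l : nat) (zeta : R)
    (P : nat -> {poly R}) : Prop :=
  [/\ forall n, size (P n) = n.+1,
      forall n, 0 < lead_coef (P n) &
      forall m n, inner l zeta (horner (P m)) (horner (P n)) = (m == n)%:R].

(* rootsR p lists the distinct real roots of p in increasing order;
   the zeros x_{1,n} < x_{2,n} < ... are indexed from 1. *)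
Definition nth_zero {R : realType} (P : nat -> {poly R}) (i n : nat) : R :=
  (rootsR (P n))`_i.-1.

(* Main.v *)
Require Import Defs.
From HB Require Import structures.
From mathcomp Require Import all_boot all_order all_algebra.
From mathcomp Require Import all_classical all_reals all_analysis.
From mathcomp Require Import measurable_realfun polyrcf.
From mathcomp Require Import ring lra.
Set Implicit Arguments.
Unset Strict Implicit.
Unset Printing Implicit Defensive.

Import Order.TTheory GRing.Theory Num.Theory.
Import numFieldNormedType.Exports.
Local Open Scope ring_scope.

(** Write L_l for the linear functional f |-> (f, 1)_{omega^(l)} on polynomials,
p for P_{n+1}^{(0)} and q for P_n^{(1)}, with leading coefficients k and kappa.
Everything follows from three properties: L_0 is strictly positive on nonzero
polynomials that are nonnegative on [1, oo), L_1 f = L_0 ((x^2 - 1) f), and the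
two orthogonality relations.

The zeros of p are simple, greater than 1, and n+1 in number because p has no
nonconstant divisor d that is nonnegative on [1, oo): if p = d s, then
orthogonality gives L_0 (d s^2) = L_0 (p s) = 0 ([nonneg_divisor_const]).  This
excludes the divisors x - a with a <= 1, the squares (x - a)^2, and a
nonconstant cofactor without real zeros, which has constant sign.

Interlacing rests on the inequality kappa < k ([lead_coef_lt]), where the
position of the ray enters.  The polynomial (x - 1) q has degree n+1 and
leading coefficient kappa, so its component along p is kappa / k and
(kappa / k)^2 <= L_0 ((x - 1)^2 q^2) < L_0 ((x^2 - 1) q^2) = 1;
the strict inequality is 2 L_0 ((x - 1) q^2) > 0.

Let p = (x - a) l.  Evaluate L_1 (q l) = L_0 ((x^2 - 1) q l) in two ways.  As l
has degree n and leading coefficient k, it is k / kappa.  Replacing (x^2 - 1) q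
by its value at a plus (x - a) r turns it into
(a^2 - 1) q(a) L_0 l + L_0 (p r), and L_0 (p r) = kappa / k.  Hence
(a^2 - 1) q(a) L_0 l = k / kappa - kappa / k > 0.  In the same way
l(a) L_0 l = L_0 (l^2) > 0, so q(a) has the sign of l(a) = p'(a)
([sign_at_zero]).  These signs alternate along the zeros of p, so q vanishes in
each of the n gaps between them, and it has no room for further zeros.

Finally, L_l is linear because all polynomials are integrable against the
weight ([integrable_horner]): the integral of (P_n)^2 equals 1, so it is finite,
and combinations of such squares dominate every polynomial. *)

(** * Polynomials and positivity on the ray [1, oo) *)

Lemma size_XsubC_mul (R : idomainType) (a : R) (s : {poly R}) : s != 0 ->
  size (('X - a%:P) * s) = (size s).+1.
Proof. by move=> s_neq0; rewrite size_monicM ?monicXsubC // size_XsubC. Qed.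

Lemma horner_remainder (R : fieldType) (f : {poly R}) a :
  exists s, ('X - a%:P) * s = f - f.[a]%:P.
Proof.
have : root (f - f.[a]%:P) a by rewrite rootE !hornerE subrr.
by move=> /factor_theorem[s fE]; exists s; rewrite mulrC fE.
Qed.

Lemma mem_rootsR (R : rcfType) (p : {poly R}) x : p != 0 ->
  (x \in rootsR p) = root p x.
Proof. by move=> p_neq0; have := roots_on_rootsR p_neq0 x; rewrite in_itv. Qed.

Lemma uniq_rootsR (R : rcfType) (p : {poly R}) : uniq (rootsR p).
Proof. by apply: (sorted_uniq lt_trans ltxx); apply: sorted_roots. Qed.

Definition nonneg_on_ray (R : rcfType) (f : {poly R}) := forall x, 1 <= x -> 0 <= f.[x].

Definition positive_on_ray (R : rcfType) (M : {poly R} -> R) :=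
  forall f, f != 0 -> nonneg_on_ray f -> 0 < M f.

Lemma nonneg_on_ray_sqr (R : rcfType) (f : {poly R}) : nonneg_on_ray (f * f).
Proof. by move=> x _; rewrite hornerM -expr2 sqr_ge0. Qed.

Lemma rootless_constant_sign (R : rcfType) (m : {poly R}) : (forall x, ~~ root m x) ->
  nonneg_on_ray m \/ nonneg_on_ray (- m).
Proof.
move=> noroot; have same_sign x y : x <= y -> 0 <= m.[x] * m.[y].
  move=> le_xy; rewrite leNgt; apply/negP => /(poly_ivtoo le_xy)[z _].
  exact/negP.
have [m1_ge0|m1_lt0] := leP 0 m.[1]; [left|right] => x /same_sign.
  by rewrite pmulr_rge0 // lt_def m1_ge0 andbT; have := noroot 1.
by rewrite nmulr_rge0 // hornerN oppr_ge0.
Qed.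

(** * Families with one polynomial of each degree *)

Section GradedBasis.
Variables (R : fieldType) (P : nat -> {poly R}).
Hypothesis size_P : forall n, size (P n) = n.+1.

Lemma graded_neq0 n : P n != 0.
Proof. by rewrite -size_poly_eq0 size_P. Qed.

Lemma graded_split n (f : {poly R}) : (size f <= n.+1)%N ->
  exists2 g : {poly R}, (size g <= n)%N &
    f = f`_n / lead_coef (P n) *: P n + g.
Proof.
move=> size_f; exists (f - f`_n / lead_coef (P n) *: P n); last by rewrite subrKC.
apply/leq_sizeP => j; rewrite leq_eqVlt => /predU1P[<-|n_lt_j].
  have lead_neq0 : lead_coef (P n) != 0 by rewrite lead_coef_eq0 graded_neq0.
  rewrite coefB coefZ -[X in _ / _ * X](_ : lead_coef (P n) = _) ?divfK ?subrr //.
  by rewrite lead_coefE size_P.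
rewrite coefB coefZ (leq_sizeP _ _ size_f j n_lt_j).
by rewrite [X in _ * X]nth_default ?size_P // mulr0 subr0.
Qed.

Lemma graded_ind (Q : {poly R} -> Prop) n : Q 0 ->
  (forall i c g, (i < n)%N -> Q g -> Q (c *: P i + g)) ->
  forall f : {poly R}, (size f <= n)%N -> Q f.
Proof.
move=> Q0; elim: n => [|n IHn] Qstep f.
  by rewrite size_poly_leq0 => /eqP->.
move=> /graded_split[g size_g ->]; apply: (Qstep) => //.
by apply: IHn => // i c h lt_in; apply: Qstep; apply: ltnW.
Qed.

End GradedBasis.

(** * Orthonormal families for a linear functional *)

Section OrthonormalFamily.
Variables (R : rcfType) (L : {scalar {poly R}}) (P : nat -> {poly R}).
Hypothesis size_P : forall n, size (P n) = n.+1.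
Hypothesis LPP : forall m n, L (P m * P n) = (m == n)%:R.

Lemma orthonormal_low n (f : {poly R}) : (size f <= n)%N -> L (P n * f) = 0.
Proof.
move: f; apply: graded_ind => //; first by rewrite mulr0 linear0.
move=> i c g lt_in Lg; rewrite mulrDr linearD Lg addr0 -scalerAr linearZ /=.
by rewrite LPP gtn_eqF // mulr0.
Qed.

Lemma orthonormal_top n (f : {poly R}) : (size f <= n.+1)%N ->
  L (P n * f) = f`_n / lead_coef (P n).
Proof.
move=> /(graded_split size_P)[g size_g {1}->].
rewrite mulrDr linearD (orthonormal_low size_g) addr0 -scalerAr linearZ /=.
by rewrite LPP eqxx mulr1.
Qed.

Hypothesis L_ge0 : forall f, nonneg_on_ray f -> 0 <= L f.

(** In f = c P_n + g with deg g < n the two terms are orthogonal, hence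
L (f^2) >= c^2. *)
Lemma orthonormal_sqr_gt0 f : f != 0 -> 0 < L (f * f).
Proof.
move=> f_neq0; have size_f : (size f <= (size f).-1.+1)%N by rewrite leqSpred.
have [g size_g fE] := graded_split size_P size_f.
set n := (size f).-1 in size_g fE; set c := _ / _ in fE.
have c_neq0 : c != 0.
  rewrite mulf_neq0 ?invr_eq0 ?lead_coef_eq0 -?[f`_n]lead_coefE ?lead_coef_eq0 //.
  exact: graded_neq0.
have -> : f * f = c ^+ 2 *: (P n * P n) + (c *: (P n * g) + c *: (P n * g)) + g * g.
  by rewrite fE -!mul_polyC rmorphXn /=; ring.
rewrite !linearD !linearZ /= (orthonormal_low size_g) LPP eqxx mulr1 !mulr0 !addr0.
by rewrite ltr_pwDl ?L_ge0 ?exprn_even_gt0 //; apply: nonneg_on_ray_sqr.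
Qed.

(** A positive functional vanishing on f >= 0 satisfies L (f g) = 0 for every g,
by the Cauchy-Schwarz argument for the form (g, h) |-> L (f g h); the choice
g = f contradicts L (f^2) > 0. *)
Lemma orthonormal_positive : positive_on_ray L.
Proof.
move=> f f_neq0 f_ge0; rewrite lt_def L_ge0 // andbT; apply/eqP => Lf0.
have Lff := orthonormal_sqr_gt0 f_neq0.
have Lfff : 0 <= L (f * (f * f)).
  by apply: L_ge0 => x x_ge1; rewrite !hornerM !mulr_ge0 ?f_ge0.
set A := L (f * f) in Lff; set B := L _ in Lfff.
(* L (f (1 - t f)^2) = - 2 t A + t^2 B; this t makes it negative, and the
   denominator B + 1 avoids a separate case B = 0. *)
pose t := A / (B + 1).
have : 0 <= L (f * ((1 - t *: f) * (1 - t *: f))).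
  apply: L_ge0 => x x_ge1; rewrite hornerM mulr_ge0 ?f_ge0 //.
  exact: nonneg_on_ray_sqr.
have -> : f * ((1 - t *: f) * (1 - t *: f)) =
    f - (t *: (f * f) + t *: (f * f)) + t ^+ 2 *: (f * (f * f)).
  by rewrite -!mul_polyC rmorphXn /=; ring.
rewrite linearD linearB linearD !linearZ /= Lf0 -/A -/B leNgt => /negP; apply.
have t_gt0 : 0 < t by rewrite divr_gt0 // ltr_wpDl.
have tB : t * B < A.
  by rewrite /t mulrAC ltr_pdivrMr ?ltr_wpDl // ltr_pM2l // ltrDl.
have tA : 0 < t * A by rewrite mulr_gt0.
have ttB : t * (t * B) < t * A by rewrite ltr_pM2l.
rewrite expr2 -mulrA; lra.
Qed.

End OrthonormalFamily.

(** * Location and number of zeros *)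

Section ZerosInRay.
Variables (R : rcfType) (L : {scalar {poly R}}).
Hypothesis L_gt0 : positive_on_ray L.
Variable p : {poly R}.
Hypothesis p_neq0 : p != 0.
Hypothesis p_orth : forall f : {poly R}, (size f < size p)%N -> L (p * f) = 0.

(** If p = d s with deg d >= 1, then deg s < deg p, so L (d s^2) = L (p s) = 0,
although d s^2 is nonnegative on the ray. *)
Lemma nonneg_divisor_const d : d %| p -> nonneg_on_ray d -> (size d <= 1)%N.
Proof.
move=> /dvdpP[s pE] d_ge0; rewrite leqNgt; apply/negP => d_gt1.
have s_neq0 : s != 0 by apply: contraNneq p_neq0; rewrite pE => ->; rewrite mul0r.
have d_neq0 : d != 0 by apply: contraNneq p_neq0; rewrite pE => ->; rewrite mulr0.
have size_s : (size s < size p)%N.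
  rewrite pE size_mul // -subn1 -addnBA ?ltnS ?(ltnW d_gt1) //.
  by rewrite -[X in (X < _)%N]addn0 ltn_add2l subn_gt0.
have := p_orth size_s; apply/eqP; rewrite gt_eqF //; apply: L_gt0.
  by rewrite mulf_neq0.
move=> x x_ge1; rewrite pE mulrAC hornerM mulr_ge0 ?d_ge0 //.
by rewrite hornerM -expr2 sqr_ge0.
Qed.

Lemma orth_root_gt1 a : root p a -> 1 < a.
Proof.
rewrite root_factor_theorem => dvd_a; rewrite ltNge; apply/negP => a_le1.
suff /(nonneg_divisor_const dvd_a) : nonneg_on_ray ('X - a%:P) by rewrite size_XsubC.
by move=> x x_ge1; rewrite hornerXsubC subr_ge0 (le_trans a_le1).
Qed.

Lemma orth_root_simple a g : p = ('X - a%:P) * g -> ~~ root g a.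
Proof.
move=> pE; apply/negP; rewrite root_factor_theorem => /dvdpP[h gE].
have sqr_dvd : ('X - a%:P) * ('X - a%:P) %| p by rewrite pE gE mulrCA dvdp_mull.
have := nonneg_divisor_const sqr_dvd (@nonneg_on_ray_sqr _ _).
by rewrite -expr2 size_exp_XsubC.
Qed.

(** The cofactor m of the linear factors of p has no real zero: such a zero
would be a multiple zero of p.  So m or - m is nonnegative, and m is constant. *)
Lemma size_rootsR_orth : size p = (size (rootsR p)).+1.
Proof.
have : \prod_(z <- rootsR p) ('X - z%:P) %| p.
  apply: uniq_roots_dvdp; last by rewrite uniq_rootsE uniq_rootsR.
  by apply/allP => x; rewrite (mem_rootsR _ p_neq0).
move=> /dvdpP[m pE]; set G := \prod_(_ <- _) _ in pE.
have m_neq0 : m != 0 by apply: contraNneq p_neq0; rewrite pE => ->; rewrite mul0r.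
have noroot x : ~~ root m x.
  apply/negP => mx; have : x \in rootsR p by rewrite (mem_rootsR _ p_neq0) pE rootM mx.
  move=> x_root; move: mx; apply/negP.
  have [h GE] : exists h, G = ('X - x%:P) * h.
    have : 'X - x%:P %| G by rewrite -root_factor_theorem root_prod_XsubC.
    by move=> /dvdpP[h ->]; exists h; rewrite mulrC.
  have /orth_root_simple : p = ('X - x%:P) * (h * m) by rewrite pE GE; ring.
  by rewrite rootM negb_or => /andP[].
have m_dvd : m %| p by rewrite pE dvdp_mulr.
have size_m : (size m <= 1)%N.
  have [|m_le0] := rootless_constant_sign noroot; first exact: nonneg_divisor_const.
  by rewrite -size_polyN nonneg_divisor_const // dvdpNl.
have -> : size p = size G.
  rewrite (size1_polyC size_m) in m_neq0 pE.
  by rewrite pE mul_polyC size_scale //; rewrite polyC_eq0 in m_neq0.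
by rewrite size_prod_XsubC.
Qed.

End ZerosInRay.

(** * Interlacing *)

Section Interlacing.
Variables (R : rcfType) (L0 L1 : {scalar {poly R}}) (P0 P1 : nat -> {poly R}).
Hypothesis L0_gt0 : positive_on_ray L0.
Hypothesis L1E : forall f, L1 f = L0 (('X^2 - 1) * f).
Hypothesis size_P0 : forall n, size (P0 n) = n.+1.
Hypothesis lead_P0 : forall n, 0 < lead_coef (P0 n).
Hypothesis LP0 : forall m n, L0 (P0 m * P0 n) = (m == n)%:R.
Hypothesis size_P1 : forall n, size (P1 n) = n.+1.
Hypothesis lead_P1 : forall n, 0 < lead_coef (P1 n).
Hypothesis LP1 : forall m n, L1 (P1 m * P1 n) = (m == n)%:R.

(** Since p is orthogonal to lower degrees and normalised, (kappa / k)^2 is the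
squared norm of the projection of (x - 1) q on p.  It is at most
L0 ((x - 1)^2 q^2), which is less than L0 ((x^2 - 1) q^2) = 1 as x - 1 < x + 1. *)
Lemma lead_coef_lt n : lead_coef (P1 n) < lead_coef (P0 n.+1).
Proof.
set q := P1 n; set p := P0 n.+1; set c := lead_coef q / lead_coef p.
have q_neq0 : q != 0 := graded_neq0 size_P1 n.
have lead_Xq : (('X - 1%:P) * q)`_n.+1 = lead_coef q.
  have <- : lead_coef (('X - 1%:P) * q) = lead_coef q.
    by rewrite lead_coefM lead_coefXsubC mul1r.
  by rewrite lead_coefE size_XsubC_mul // size_P1.
have Lpq : L0 (p * (('X - 1%:P) * q)) = c.
  by rewrite (orthonormal_top size_P0 LP0) ?lead_Xq // size_XsubC_mul // size_P1.
have Lqq : L0 (('X^2 - 1) * (q * q)) = 1 by rewrite -L1E LP1 eqxx.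
have Lpp : L0 (p * p) = 1 by rewrite LP0 eqxx.
have LXqq : 0 < L0 (('X - 1%:P) * (q * q)).
  apply: L0_gt0 => [|x x_ge1]; first by rewrite !mulf_neq0 // polyXsubC_eq0.
  by rewrite hornerM mulr_ge0 ?nonneg_on_ray_sqr // hornerXsubC subr_ge0.
(* f is the part of (x - 1) q orthogonal to p. *)
pose f := ('X - 1%:P) * q - c *: p.
have Lff : 0 <= L0 (f * f).
  have [->|f_neq0] := eqVneq f 0; first by rewrite mul0r linear0.
  by rewrite ltW // L0_gt0 ?mulf_neq0 //; apply: nonneg_on_ray_sqr.
(* (x - 1)^2 = (x^2 - 1) - 2 (x - 1) isolates the squared norm of q. *)
have ffE : f * f = ('X^2 - 1) * (q * q)
    - ('X - 1%:P) * (q * q) - ('X - 1%:P) * (q * q)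
    - c *: (p * (('X - 1%:P) * q)) - c *: (p * (('X - 1%:P) * q))
    + c ^+ 2 *: (p * p).
  by rewrite /f -!mul_polyC rmorphXn /= polyC1; ring.
have c_gt0 : 0 < c by apply: divr_gt0; [apply: lead_P1 | apply: lead_P0].
have c_lt1 : c < 1.
  have LpqZ : L0 (c *: (p * (('X - 1%:P) * q))) = c * c by rewrite linearZ /= Lpq.
  have LppZ : L0 (c ^+ 2 *: (p * p)) = c * c by rewrite linearZ /= Lpp mulr1 expr2.
  rewrite ffE linearD !linearB /= Lqq LpqZ LppZ in Lff.
  have c2_lt1 : c ^+ 2 < 1 by rewrite expr2; lra.
  by rewrite expr_lt1 ?ltW in c2_lt1.
by move: c_lt1; rewrite /c ltr_pdivrMr ?mul1r //; apply: lead_P0.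
Qed.

(** With p = (x - a) l, the factors in (q(a) L0 l) (l(a) L0 l) are positive:
evaluating L1 (q l) in two ways gives q(a) L0 l = (k / kappa - kappa / k) /
(a^2 - 1), and l(a) L0 l = L0 (l^2).  The quotient L0 l / l(a) is the
Christoffel number of the node a. *)
Lemma sign_at_zero n a l : P0 n.+1 = ('X - a%:P) * l -> 0 < (P1 n).[a] * l.[a].
Proof.
move=> pE; have a_gt1 : 1 < a.
  apply: (orth_root_gt1 L0_gt0 (graded_neq0 size_P0 n.+1)); last first.
    by rewrite pE rootM root_XsubC eqxx.
  by move=> f; rewrite size_P0 ltnS; apply: (orthonormal_low size_P0 LP0).
have k_lt := lead_coef_lt n.
have p_neq0 := graded_neq0 size_P0 n.+1; have q_neq0 := graded_neq0 size_P1 n.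
have lead_p := lead_P0 n.+1; have lead_q := lead_P1 n.
have size_p := size_P0 n.+1; have size_q := size_P1 n.
have Lp_low := orthonormal_low size_P0 LP0 (n := n.+1).
have Lp_top := orthonormal_top size_P0 LP0 (n := n.+1).
have Lq_top := orthonormal_top size_P1 LP1 (n := n).
set p := P0 n.+1 in pE p_neq0 lead_p size_p k_lt Lp_low Lp_top.
set q := P1 n in q_neq0 lead_q size_q k_lt Lq_top *.
have l_neq0 : l != 0 by apply: contraNneq p_neq0; rewrite pE => ->; rewrite mulr0.
have size_l : size l = n.+1.
  by apply: succn_inj; rewrite -size_p pE size_XsubC_mul.
have lead_l : l`_n = lead_coef p.
  by rewrite pE lead_coefM lead_coefXsubC mul1r lead_coefE size_l.
have Lll : L0 (l * l) = l.[a] * L0 l.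
  have [s sE] := horner_remainder l a.
  have size_s : (size s <= n.+1)%N.
    have [->|s_neq0] := eqVneq s 0; first by rewrite size_poly0.
    rewrite -ltnS -(size_XsubC_mul a s_neq0) sE.
    rewrite (leq_trans (size_polyD _ _)) // geq_max size_l leqnSn size_polyN.
    by rewrite (leq_trans (size_polyC_leq1 _)).
  have -> : l * l = l.[a] *: l + p * s.
    by rewrite pE mulrAC sE -mul_polyC; ring.
  by rewrite linearD linearZ /= Lp_low // addr0.
have Lql : (a ^+ 2 - 1) * q.[a] * L0 l = lead_coef p / lead_coef q - lead_coef q / lead_coef p.
  have size_X2 : size ('X^2 - 1 : {poly R}) = 3 by rewrite size_XnsubC.
  have lead_X2 : lead_coef ('X^2 - 1 : {poly R}) = 1.
    by rewrite -polyC1; apply/monicP; apply: monicXnsubC.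
  have X2_neq0 : ('X^2 - 1 : {poly R}) != 0 by rewrite -size_poly_eq0 size_X2.
  have [r rE] := horner_remainder (('X^2 - 1) * q) a; set c := _.[a] in rE.
  have size_X2q : size (('X^2 - 1) * q) = n.+3.
    by rewrite size_mul // size_X2 size_q.
  have size_c : (size (- c%:P)%R < size (('X^2 - 1) * q)%R)%N.
    by rewrite size_polyN size_X2q (leq_ltn_trans (size_polyC_leq1 _)).
  have size_Xr : size (('X - a%:P) * r) = n.+3 by rewrite rE size_polyDl.
  have r_neq0 : r != 0.
    by apply/eqP => r0; rewrite r0 mulr0 size_poly0 in size_Xr.
  have size_r : size r = n.+2.
    by apply: succn_inj; rewrite -size_Xr size_XsubC_mul.
  have lead_r : r`_n.+1 = lead_coef q.
    have <- : lead_coef r = r`_n.+1 by rewrite lead_coefE size_r.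
    rewrite -[LHS]mul1r -(lead_coefXsubC a) -lead_coefM rE lead_coefDl //.
    by rewrite lead_coefM lead_X2 mul1r.
  have : L1 (q * l) = lead_coef p / lead_coef q by rewrite Lq_top ?lead_l ?size_l.
  rewrite L1E mulrA.
  have -> : ('X^2 - 1) * q * l = c *: l + p * r.
    by rewrite pE [_ * l * r]mulrAC rE -mul_polyC; ring.
  rewrite linearD linearZ /= Lp_top ?size_r // lead_r => <-.
  by rewrite addrK /c !hornerE.
have Lll_gt0 : 0 < l.[a] * L0 l.
  by rewrite -Lll L0_gt0 ?mulf_neq0 //; apply: nonneg_on_ray_sqr.
have Lql_gt0 : 0 < (a ^+ 2 - 1) * q.[a] * L0 l.
  rewrite Lql subr_gt0 (@lt_trans _ _ 1) //.
    by rewrite ltr_pdivrMr // mul1r.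
  by rewrite ltr_pdivlMr // mul1r.
have a2_gt0 : 0 < a ^+ 2 - 1 by rewrite subr_gt0 exprn_egt1.
have : 0 < (a ^+ 2 - 1) * L0 l ^+ 2 * (q.[a] * l.[a]).
  have -> : (a ^+ 2 - 1) * L0 l ^+ 2 * (q.[a] * l.[a]) =
    (a ^+ 2 - 1) * q.[a] * L0 l * (l.[a] * L0 l) by ring.
  exact: mulr_gt0.
rewrite pmulr_rgt0 // mulr_gt0 // exprn_even_gt0 //=.
by apply: contraTneq Lll_gt0 => ->; rewrite mulr0 ltxx.
Qed.

(** With p = (x - a) (x - b) g, the cofactors of x - a at a and of x - b at b are
(a - b) g(a) and (b - a) g(b), and g keeps its sign on [a, b] because p has only
simple zeros.  So [sign_at_zero] gives q opposite signs at a and b. *)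
Lemma sign_change n a b : a < b -> root (P0 n.+1) a -> root (P0 n.+1) b ->
  (forall x, a < x < b -> ~~ root (P0 n.+1) x) ->
  (P1 n).[a] * (P1 n).[b] < 0.
Proof.
move=> lt_ab root_a root_b noroot.
have simple c h : P0 n.+1 = ('X - c%:P) * h -> ~~ root h c.
  apply: (orth_root_simple L0_gt0 (graded_neq0 size_P0 n.+1)) => f.
  by rewrite size_P0 ltnS; apply: (orthonormal_low size_P0 LP0).
have [h pE] : exists h, P0 n.+1 = ('X - a%:P) * h.
  by have /factor_theorem[h ->] := root_a; exists h; rewrite mulrC.
have [g hE] : exists g, h = ('X - b%:P) * g.
  have : root h b by move: root_b; rewrite pE rootM root_XsubC gt_eqF.
  by move=> /factor_theorem[g ->]; exists g; rewrite mulrC.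
have pEa : P0 n.+1 = ('X - a%:P) * (('X - b%:P) * g) by rewrite pE hE.
have pEb : P0 n.+1 = ('X - b%:P) * (('X - a%:P) * g) by rewrite pEa mulrCA.
have gab_gt0 : 0 < g.[a] * g.[b].
  rewrite ltNge; apply/negP => /(polyrcf.poly_ivt (ltW lt_ab))[x].
  rewrite in_itv /= => /andP[le_ax le_xb] root_gx.
  have [eq_ax|ne_ax] := eqVneq a x.
    by have := simple _ _ pEa; rewrite rootM negb_or eq_ax root_gx andbF.
  have [eq_xb|ne_xb] := eqVneq x b.
    by have := simple _ _ pEb; rewrite rootM negb_or -eq_xb root_gx andbF.
  have /noroot : a < x < b by rewrite !lt_neqAle ne_ax ne_xb le_ax.
  by rewrite pEa !rootM root_gx !orbT.
have := sign_at_zero pEa; have := sign_at_zero pEb.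
rewrite !hornerM !hornerXsubC => qb_gt0 qa_gt0.
have : 0 < - ((b - a) ^+ 2 * (g.[a] * g.[b])) * ((P1 n).[a] * (P1 n).[b]).
  have -> : - ((b - a) ^+ 2 * (g.[a] * g.[b])) * ((P1 n).[a] * (P1 n).[b]) =
    ((P1 n).[a] * ((a - b) * g.[a])) * ((P1 n).[b] * ((b - a) * g.[b])) by ring.
  exact: mulr_gt0.
rewrite nmulr_rgt0 // oppr_lt0 mulr_gt0 // exprn_even_gt0 //=.
by rewrite subr_eq0 gt_eqF.
Qed.

Lemma interlacing n :
  [/\ size (rootsR (P1 n)) = n,
      size (rootsR (P0 n.+1)) = n.+1,
      forall x, x \in rootsR (P0 n.+1) -> 1 < x &
      forall i, (i < n)%N ->
        (rootsR (P0 n.+1))`_i < (rootsR (P1 n))`_i < (rootsR (P0 n.+1))`_i.+1].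
Proof.
have p_neq0 := graded_neq0 size_P0 n.+1; have q_neq0 := graded_neq0 size_P1 n.
have p_orth (f : {poly R}) : (size f < size (P0 n.+1))%N -> L0 (P0 n.+1 * f) = 0.
  by rewrite size_P0 ltnS; apply: (orthonormal_low size_P0 LP0).
set rs := rootsR (P0 n.+1).
have size_rs : size rs = n.+1.
  by apply: succn_inj; rewrite -(size_rootsR_orth L0_gt0 p_neq0 p_orth) size_P0.
have rs_sorted : sorted <%R rs by apply: sorted_roots.
have rs_mono : {in [pred i | (i < n.+1)%N] &, {mono nth 0 rs : i j / (i < j)%N >-> i < j}}.
  by rewrite -size_rs; apply: lt_sorted_ltn_nth.
have root_rs i : (i < n.+1)%N -> root (P0 n.+1) rs`_i.
  by move=> lt_in; rewrite -(mem_rootsR _ p_neq0) mem_nth // size_rs.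
have gap i : exists x, (i < n)%N -> rs`_i < x < rs`_i.+1 /\ root (P1 n) x.
  have [lt_in|] := boolP (i < n)%N; last by exists 0.
  have lt_rs : rs`_i < rs`_i.+1 by rewrite rs_mono ?inE // ltnW.
  have : (P1 n).[rs`_i] * (P1 n).[rs`_i.+1] < 0.
    apply: sign_change => //; try by apply: root_rs; rewrite // ltnW.
    move=> x /andP[lt_ix lt_xi]; rewrite -(mem_rootsR _ p_neq0); apply/negP.
    move=> /(nthP 0)[j]; rewrite size_rs => lt_jn xE; move: lt_ix lt_xi.
    rewrite -xE !rs_mono ?inE //; last by rewrite ltnW.
    by move=> lt_ij; rewrite ltnS leqNgt lt_ij.
  move=> /(poly_ivtoo (ltW lt_rs))[x]; rewrite in_itv /= => x_in root_x.
  by exists x.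
(* The n zeros y i of q, one in each gap, exhaust the zeros of q by degree. *)
have [y yP] := choice gap.
have size_ys : size (mkseq y n) = n by rewrite size_mkseq.
have ys_sorted : sorted <%R (mkseq y n).
  apply/(sortedP 0) => i; rewrite size_ys => lt_in.
  rewrite !nth_mkseq // ?(ltnW lt_in) //.
  have [/andP[_ lt_yi] _] := yP i (ltnW lt_in); have [/andP[lt_iy _] _] := yP _ lt_in.
  exact: lt_trans lt_iy.
have ys_roots : {subset mkseq y n <= rootsR (P1 n)}.
  move=> x /(nthP 0)[i]; rewrite size_ys => lt_in <-.
  by rewrite nth_mkseq // (mem_rootsR _ q_neq0); case: (yP i lt_in).
have size_qs : (size (rootsR (P1 n)) <= size (mkseq y n))%N.
  rewrite size_ys -ltnS -(size_P1 n) max_poly_roots ?uniq_rootsR //.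
  by apply/allP => x; rewrite mem_rootsR.
have qsE : rootsR (P1 n) = mkseq y n.
  apply: lt_sorted_eq; rewrite ?ys_sorted //; first exact: sorted_roots.
  have ys_uniq : uniq (mkseq y n) by apply: (sorted_uniq lt_trans ltxx).
  by have [_ E] := uniq_min_size ys_uniq ys_roots size_qs; move=> x; rewrite E.
split=> //; first by rewrite qsE.
  by move=> x; rewrite (mem_rootsR _ p_neq0); apply: (orth_root_gt1 L0_gt0 p_neq0 p_orth).
by move=> i lt_in; rewrite qsE nth_mkseq //; case: (yP i lt_in).
Qed.

End Interlacing.

(** * The functionals given by the weights *)

Section WeightedIntegral.
Variables (R : realType) (l : nat) (zeta : R).
Let mu := @lebesgue_measure R.
Let ray : set R := `[1, +oo[%classic.
Let integrand (f : {poly R}) x := f.[x] * weight l zeta x.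

Lemma weight_ge0 x : 0 <= weight l zeta x.
Proof.
rewrite /weight !mulr_ge0 ?powR_ge0 ?expR_ge0 ?invr_ge0 //.
apply: Rintegral_ge0 => t _; rewrite mulr_ge0 ?expR_ge0 //.
by rewrite /cosh divr_ge0 ?addr_ge0 ?expR_ge0.
Qed.

Lemma measurable_weight D : measurable_fun D (weight l zeta).
Proof.
apply: (measurable_funS measurableT) => //.
apply: measurable_funM.
  apply: measurable_funM => //.
  apply: (measurableT_comp (measurable_powR _)).
  by apply: measurable_funB => //; apply: measurable_funX.
apply: measurableT_comp => //; exact: mulrl_measurable.
Qed.

Lemma measurable_integrand D f : measurable_fun D (integrand f).
Proof.
apply: measurable_funM; last exact: measurable_weight.
apply: (measurable_funS measurableT) => //.
by apply: continuous_measurable_fun => x; apply: continuous_horner.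
Qed.

Definition moment (f : {poly R}) : R := \int[mu]_(x in ray) integrand f x.

Lemma inner_moment f g : inner l zeta (horner f) (horner g) = moment (f * g).
Proof. by apply: eq_Rintegral => x _; rewrite /integrand hornerM. Qed.

Lemma moment_ge0 f : nonneg_on_ray f -> 0 <= moment f.
Proof.
move=> f_ge0; apply: Rintegral_ge0 => x.
by rewrite /ray /= in_itv /= andbT => /f_ge0 fx_ge0; rewrite mulr_ge0 ?weight_ge0.
Qed.

Let integrable_poly f := mu.-integrable ray (EFin \o integrand f).

(** The real-valued integral is 0 when the extended one is infinite, so a
nonzero moment of a nonnegative integrand certifies integrability. *)
Lemma integrable_of_moment f : nonneg_on_ray f -> moment f != 0 ->
  integrable_poly f.
Proof.
move=> f_ge0 Mf; apply/integrableP; split.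
  by apply/measurable_EFinP; apply: measurable_integrand.
have -> : (\int[mu]_(x in ray) `|(EFin \o integrand f) x| =
    \int[mu]_(x in ray) (integrand f x)%:E)%E.
  apply: eq_integral => x; rewrite inE /ray /= in_itv /= andbT => x_ge1.
  by rewrite ger0_norm // mulr_ge0 ?weight_ge0 ?f_ge0.
rewrite ltNge leye_eq; apply: contra Mf => /eqP int_oo.
by rewrite /moment /Rintegral int_oo.
Qed.

Lemma integrable_lincomb a f g : integrable_poly f -> integrable_poly g ->
  integrable_poly (a *: f + g).
Proof.
move=> int_f int_g.
have mray : measurable (ray : set (measurableTypeR R)) by exact: measurable_itv.
have := integrableD mray (integrableZl mray a int_f) int_g.
apply: eq_integrable => // x _.
by rewrite /= /integrand hornerD hornerZ mulrDl -mulrA EFinD EFinM.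
Qed.

Variable P : nat -> {poly R}.
Hypothesis P_orthonormal : orthonormal_polys l zeta P.

(** As P_0 is a nonzero constant, P_n is a multiple of P_0 P_n, which is
dominated by P_0^2 + P_n^2; and the P_n span all polynomials. *)
Lemma integrable_horner f : integrable_poly f.
Proof.
have [size_P _ P_orth] := P_orthonormal.
have mray : measurable (ray : set (measurableTypeR R)) by exact: measurable_itv.
have int_sqr n : integrable_poly (P n * P n).
  apply: integrable_of_moment; first exact: nonneg_on_ray_sqr.
  by rewrite -inner_moment P_orth eqxx oner_eq0.
have int_0 : integrable_poly 0.
  by have := integrable_lincomb (-1) (int_sqr 0) (int_sqr 0); rewrite scaleN1r addNr.
have c0_neq0 : (P 0)`_0 != 0.
  have <- : lead_coef (P 0) = (P 0)`_0 by rewrite lead_coefE size_P.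
  by rewrite lead_coef_eq0 (graded_neq0 size_P).
have P0E : P 0 = ((P 0)`_0)%:P by apply: size1_polyC; rewrite size_P.
have int_P n : integrable_poly (P n).
  have int_sum := integrable_lincomb 1 (int_sqr n) (int_sqr 0).
  have int_prod : integrable_poly (P 0 * P n).
    apply: le_integrable int_sum => //.
      by apply/measurable_EFinP; apply: measurable_integrand.
    move=> x _; rewrite /= lee_fin normrM [leRHS]normrM ler_wpM2r //.
    set u := (P 0).[x]; set v := (P n).[x].
    have -> : (P 0 * P n).[x] = u * v by rewrite hornerM.
    have -> : (1 *: (P n * P n) + P 0 * P 0).[x] = v ^+ 2 + u ^+ 2.
      by rewrite scale1r hornerD !hornerM -!expr2.
    rewrite [leRHS]ger0_norm ?addr_ge0 ?sqr_ge0 // ler_norml.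
    have := sqr_ge0 (u + v); have := sqr_ge0 (u - v).
    have := sqr_ge0 u; have := sqr_ge0 v.
    by move=> *; apply/andP; split; nra.
  have -> : P n = ((P 0)`_0)^-1 *: (P 0 * P n) + 0.
    by rewrite [X in X * _]P0E addr0 mul_polyC scalerA mulVf // scale1r.
  exact: integrable_lincomb.
apply: (graded_ind size_P (Q := integrable_poly) (n := size f)) => //.
by move=> i c g _; apply: integrable_lincomb.
Qed.

Lemma moment_lincomb a f g : moment (a *: f + g) = a * moment f + moment g.
Proof.
have mray : measurable (ray : set (measurableTypeR R)) by exact: measurable_itv.
rewrite -(RintegralZl a mray (integrable_horner f)).
rewrite -(RintegralD mray _ (integrable_horner g)).
  by apply: eq_Rintegral => x _; rewrite /integrand hornerD hornerZ mulrDl -mulrA.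
have := integrableZl mray a (integrable_horner f).
by apply: eq_integrable => // x _; rewrite /= EFinM.
Qed.

End WeightedIntegral.

(** At x = 1 both sides are 0, because 0 `^ (- 1 / 2) = 0 by convention. *)
Lemma weight1E (R : realType) (zeta x : R) : 1 <= x ->
  weight 1 zeta x = (x ^+ 2 - 1) * weight 0 zeta x.
Proof.
move=> x_ge1; rewrite /weight; set y := x ^+ 2 - 1.
suff -> : y `^ (1%:R - 1 / 2) = y * y `^ (0%:R - 1 / 2) by ring.
have [y0|y_neq0] := eqVneq y 0.
  rewrite y0 mul0r powR0 //; lra.
have y_ge0 : 0 <= y by rewrite subr_ge0 expr_ge1 // (le_trans _ x_ge1).
have -> : (1%:R - 1 / 2 : R) = 1 + (0%:R - 1 / 2) by ring.
by rewrite powRD ?y_neq0 ?implybT // powRr1.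
Qed.

Lemma moment1E (R : realType) (zeta : R) f :
  moment 1 zeta f = moment 0 zeta (('X^2 - 1) * f).
Proof.
apply: eq_Rintegral => x; rewrite inE /= in_itv /= andbT => x_ge1.
have -> : (('X^2 - 1) * f).[x] = (x ^+ 2 - 1) * f.[x] by rewrite hornerM !hornerE.
by rewrite weight1E // mulrCA mulrA.
Qed.

(** * Interlacing of the zeros *)

Theorem theorem3p6 (R : realType) (zeta : R) (P0 P1 : nat -> {poly R}) (n : nat)
    (zeta_gt0 : 0 < zeta)
    (P0_orthonormal : orthonormal_polys 0 zeta P0)
    (P1_orthonormal : orthonormal_polys 1 zeta P1)
    (n_ge1 : (1 <= n)%N) :
  [/\ size (rootsR (P1 n)) = n,
      size (rootsR (P0 n.+1)) = n.+1,
      1 < nth_zero P0 1 n.+1 &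
      forall i : nat, (1 <= i <= n)%N ->
        nth_zero P0 i n.+1 < nth_zero P1 i n /\ nth_zero P1 i n < nth_zero P0 i.+1 n.+1].
Proof.
have [size_P0 lead_P0 orth_P0] := P0_orthonormal.
have [size_P1 lead_P1 orth_P1] := P1_orthonormal.
have lin0 : linear_for *%R (moment 0 zeta) := moment_lincomb P0_orthonormal.
have lin1 : linear_for *%R (moment 1 zeta) := moment_lincomb P1_orthonormal.
pose M0mixin := GRing.isLinear.Build R {poly R} R *%R (moment 0 zeta) lin0.
pose M1mixin := GRing.isLinear.Build R {poly R} R *%R (moment 1 zeta) lin1.
pose L0 : {scalar {poly R}} := HB.pack (moment 0 zeta) M0mixin.
pose L1 : {scalar {poly R}} := HB.pack (moment 1 zeta) M1mixin.
have LP0 i j : L0 (P0 i * P0 j) = (i == j)%:R by rewrite -orth_P0 inner_moment.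
have LP1 i j : L1 (P1 i * P1 j) = (i == j)%:R by rewrite -orth_P1 inner_moment.
have L0_gt0 : positive_on_ray L0.
  by apply: (orthonormal_positive size_P0 LP0) => f; apply: moment_ge0.
have L1E f : L1 f = L0 (('X^2 - 1) * f) := moment1E zeta f.
have [size_q size_p p_gt1 lt_zeros] :=
  interlacing L0_gt0 L1E size_P0 lead_P0 LP0 size_P1 lead_P1 LP1 n.
split=> //; first by apply/p_gt1/mem_nth; rewrite size_p.
move=> [//|i] /= lt_in; have /andP[lt_pq lt_qp] := lt_zeros i lt_in.
by split.
Qed.
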